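(* Let $\{\ket{\Phi_b}\}_{b=1}^{2^{n+m}}$ be a stabilizer basis of $\mathcal{H}_n\otimes\mathcal{H}_m$, let $\ket\psi\in\mathcal{H}_m$ be an arbitrary unit vector, and let $\mu_b=(I\otimes\bra\psi)\ket{\Phi_b}\!\bra{\Phi_b}(I\otimes\ket\psi)$. Let $p$ be the entanglement entropy of the states $\ket{\Phi_b}$ across the bipartition $\mathcal{H}_n|\mathcal{H}_m$. Then $s_{\boldsymbol\mu}\le 2^{n+p}$. In particular, for a given such stabilizer basis, an informationally complete POVM of this form (for a suitable $\ket\psi$) is possible if and only if the states $\ket{\Phi_b}$ are maximally entangled, i.e. $m\ge n$ and $p=n$.
   Context: $\mathcal{H}_n=(\mathbb{C}^2)^{\otimes n}$ (data qubits), $\mathcal{H}_m=(\mathbb{C}^2)^{\otimes m}$ (ancilla qubits). A stabilizer basis of $k$ qubits is the orthonormal basis of common eigenvectors of $k$ independent pairwise commuting Pauli operators; such bases arise as $\ket{\Phi_b}=U^\dagger\ket{\Phi'_b}$ with $U$ Clifford and $\{\ket{\Phi_b'}\}$ a stabilizer basis. The entanglement entropy of a pure state is the von Neumann entropy (base 2) of its reduced state on $\mathcal{H}_n$; for a stabilizer basis this is an integer $0\le p\le\min(n,m)$, the same for all basis elements. $s_{\boldsymbol\mu}=\dim\operatorname{span}(\{\mu_b\})$; $\boldsymbol\mu$ is informationally complete (IC) if $s_{\boldsymbol\mu}=4^n$. *)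

(* Defs.v *)
From HB Require Import structures.
From mathcomp Require Import all_boot all_order all_algebra.
From mathcomp Require Import reals exp.
From mathcomp.real_closed Require Import complex mxtens.

Unset Printing Implicit Defensive.

Import Order.TTheory GRing.Theory Num.Theory.
Local Open Scope ring_scope.

Section QuantumDefs.
Context {R : realType}.
Local Notation C := R[i].

Definition adjmx {m n} (A : 'M[C]_(m, n)) : 'M[C]_(n, m) :=
  map_mx Num.conj A^T.

(* Single-qubit Pauli matrices: 0 = I, 1 = X, 2 = Y, 3 = Z
   (computational basis |0>, |1>). *)
Definition pauli1 (a : 'I_4) : 'M[C]_2 :=
  \matrix_(i < 2, j < 2)
    match val a with
    | 0 => (i == j)%:R
    | 1 => (i != j)%:R
    | 2 => if i == j then 0 else if val i == 0%N then - 'i else 'i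
    | _ => if i == j then (if val i == 0%N then 1 else -1) else 0
    end.

(* Pauli string sigma_{s (k-1)} (x) ... (x) sigma_{s 0} on k qubits,
   (C^2)^{(x) k} = C^(2^k), Kronecker product convention of tensmx. *)
Fixpoint pauli_str (k : nat) (s : nat -> 'I_4) : 'M[C]_(2 ^ k) :=
  match k return 'M[C]_(2 ^ k) with
  | 0 => 1%:M
  | k'.+1 => castmx (esym (expnS 2 k'), esym (expnS 2 k'))
                    (tensmx (pauli1 (s k')) (pauli_str k' s))
  end.

Definition pauli_phase (c : C) : Prop := [\/ c = 1, c = -1, c = 'i | c = - 'i].

Definition is_pauli_nm (n m : nat) (P : 'M[C]_(2 ^ n * 2 ^ m)) : Prop :=
  exists c s t, pauli_phase c /\ P = c *: tensmx (pauli_str n s) (pauli_str m t).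

(* A stabilizer basis of k qubits living in C^N (N = 2^k): an orthonormal
   basis consisting of common eigenvectors of k independent pairwise commuting
   Pauli operators (independent: no nonempty product of them is a scalar). *)
Definition stabilizer_basis (k N : nat) (isPauli : 'M[C]_N -> Prop)
    (Phi : 'I_N -> 'cV[C]_N) : Prop :=
  (forall b b', adjmx (Phi b) *m Phi b' = ((b == b')%:R)%:M) /\
  exists g : 'I_k -> 'M[C]_N,
    [/\ forall i, isPauli (g i),
        forall i j, g i *m g j = g j *m g i,
        forall S : {set 'I_k}, S != set0 ->
          ~~ is_scalar_mx (\big[@mulmx C N N N/1%:M]_(i in S) g i)
      & forall i b, exists lam : C, g i *m Phi b = lam *: Phi b].

Definition anc_bra (n m : nat) (psi : 'cV[C]_(2 ^ m)) : 'M[C]_(2 ^ n, 2 ^ n * 2 ^ m) :=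
  castmx (muln1 (2 ^ n)%N, erefl (2 ^ n * 2 ^ m)%N)
         (tensmx (1%:M : 'M[C]_(2 ^ n)) (adjmx psi)).

Definition ptrace_anc (n m : nat) (rho : 'M[C]_(2 ^ n * 2 ^ m)) : 'M[C]_(2 ^ n) :=
  \sum_(j < 2 ^ m)
     anc_bra n m (delta_mx j 0) *m rho *m adjmx (anc_bra n m (delta_mx j 0)).

Definition povm_elt (n m : nat) (psi : 'cV[C]_(2 ^ m)) (v : 'cV[C]_(2 ^ n * 2 ^ m)) :
    'M[C]_(2 ^ n) :=
  anc_bra n m psi *m (v *m adjmx v) *m adjmx (anc_bra n m psi).

Definition s_mu (n m : nat) (psi : 'cV[C]_(2 ^ m))
    (Phi : 'I_(2 ^ n * 2 ^ m) -> 'cV[C]_(2 ^ n * 2 ^ m)) : nat :=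
  \rank (\matrix_(b < 2 ^ n * 2 ^ m) mxvec (povm_elt n m psi (Phi b))).

Definition xlog2 (x : R) : R := if x == 0 then 0 else x * ln x / ln 2.

(* von Neumann entropy (base 2) of a density matrix rho equals S:
   rs is the list of eigenvalues of rho with multiplicity (roots of the
   characteristic polynomial), and S = - sum_r r log2 r. *)
Definition vN_entropy_is {d : nat} (rho : 'M[C]_d) (S : R) : Prop :=
  exists rs : seq C,
    char_poly rho = \prod_(r <- rs) ('X - r%:P) /\
    S = - \sum_(r <- rs) xlog2 (complex.Re r).

Definition ent_entropy_is (n m : nat) (v : 'cV[C]_(2 ^ n * 2 ^ m)) (S : R) : Prop :=
  vN_entropy_is (ptrace_anc n m (v *m adjmx v)) S.

Definition unit_vec {d : nat} (psi : 'cV[C]_d) : Prop := adjmx psi *m psi = 1%:M.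

End QuantumDefs.

(* Main.v *)
(** Let G be the group of Pauli strings, modulo phases, having every [Phi b] as
an eigenvector. Each projector [Phi b (Phi b)^*] is 1/N times a signed sum of
the elements of G, and conversely each element of G is a combination of these
projectors; sandwiching with psi, the span of the mu_b consists of the data
factors s of those (s, t) in G with <psi|t|psi> nonzero, so it has dimension at
most |proj G|, where proj keeps the data factor, with equality if psi has no
vanishing Pauli expectation (a product of generic qubit states).

Let GA and GB be the subgroups of G supported on the data and on the ancilla.
The reduced state rho satisfies rho^2 = (|GA| / 2^n) rho, so the entropy p is
given by |GA| 2^p = 2^n. The purities of the two reduced states agree, hence
|GB| 2^p = 2^m, and |proj G| = |G| / |GB| = 2^(n + m) / |GB| = 2^(n + p). *)
Require Import Defs.
From HB Require Import structures.
From mathcomp Require Import all_boot all_order all_algebra.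
From mathcomp Require Import reals exp.
From mathcomp Require Import ring.
From mathcomp.real_closed Require Import complex mxtens.
Import GRing.Theory Num.Theory.
Local Open Scope ring_scope.

(** * Adjoints, traces and Kronecker products *)

Section Adjoint.
Context {R : realType}.
Local Notation C := R[i].

Lemma adjmxM {m n k} (A : 'M[C]_(m, n)) (B : 'M[C]_(n, k)) :
  adjmx (A *m B) = adjmx B *m adjmx A.
Proof. by rewrite /adjmx trmx_mul map_mxM. Qed.

Lemma adjmxK {m n} (A : 'M[C]_(m, n)) : adjmx (adjmx A) = A.
Proof. by apply/matrixP => i j; rewrite !mxE conjCK. Qed.

Lemma adjmxZ {m n} c (A : 'M[C]_(m, n)) : adjmx (c *: A) = c^* *: adjmx A.
Proof. by apply/matrixP => i j; rewrite !mxE rmorphM. Qed.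

Lemma adjmx_tens {m n k l} (A : 'M[C]_(m, n)) (B : 'M[C]_(k, l)) :
  adjmx (tensmx A B) = tensmx (adjmx A) (adjmx B).
Proof. by rewrite /adjmx trmx_tens map_mxT. Qed.

Lemma adjmx_cast {m n m' n'} (e : m = m') (e' : n = n') (A : 'M[C]_(m, n)) :
  adjmx (castmx (e, e') A) = castmx (e', e) (adjmx A).
Proof. by case: m' / e; case: n' / e'; rewrite !castmx_id. Qed.

Lemma mxtrace_adj {n} (A : 'M[C]_n) : \tr (adjmx A) = (\tr A)^*.
Proof. by rewrite /mxtrace rmorph_sum; apply: eq_bigr => i _; rewrite !mxE. Qed.

Lemma sum_mxtens_index {m n} (F : 'I_(m * n) -> C) :
  \sum_k F k = \sum_i \sum_j F (mxtens_index (i, j)).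
Proof.
rewrite pair_big; apply: reindex => //=.
exists (@mxtens_unindex m n) => k _.
  by rewrite -surjective_pairing mxtens_indexK.
by rewrite -surjective_pairing mxtens_unindexK.
Qed.

Lemma sum_mxvec_index {m n} (F : 'I_(m * n) -> C) :
  \sum_k F k = \sum_i \sum_j F (mxvec_index i j).
Proof.
by rewrite pair_bigA (reindex _ (curry_mxvec_bij _ _)); apply: eq_bigr => -[].
Qed.

Lemma mxtrace_tens {m n} (A : 'M[C]_m) (B : 'M[C]_n) :
  \tr (tensmx A B) = \tr A * \tr B.
Proof.
rewrite /mxtrace sum_mxtens_index mulr_suml; apply: eq_bigr => i _.
by rewrite mulr_sumr; apply: eq_bigr => j _; rewrite tensmxE.
Qed.

Lemma mxtrace_castmx {m n} (e : m = n) (A : 'M[C]_m) : \tr (castmx (e, e) A) = \tr A.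
Proof. by case: n / e; rewrite castmx_id. Qed.

Lemma tensmx11 m n : tensmx (1%:M : 'M[C]_m) (1%:M : 'M[C]_n) = 1%:M.
Proof.
apply/matrixP => i j; case: (mxtens_indexP i) => a b; case: (mxtens_indexP j) => a' b'.
rewrite tensmxE !mxE -natrM mulnb (can_eq (@mxtens_indexK m n)).
by rewrite xpair_eqE.
Qed.

Lemma tensmxZl {m n k l} c (A : 'M[C]_(m, n)) (B : 'M[C]_(k, l)) :
  tensmx (c *: A) B = c *: tensmx A B.
Proof. by apply/matrixP => i j; rewrite !mxE mulrA. Qed.

Lemma tensmxZr {m n k l} c (A : 'M[C]_(m, n)) (B : 'M[C]_(k, l)) :
  tensmx A (c *: B) = c *: tensmx A B.
Proof. by apply/matrixP => i j; rewrite !mxE mulrCA. Qed.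

End Adjoint.

(** * Pauli frames *)

Section Frame.
Context {R : realType}.
Local Notation C := R[i].

(* All that is needed of the Pauli strings, in a form stable under tensor products. *)
Record pauli_frame (d : nat) (L : finType) (P : L -> 'M[C]_d) (e : L) : Prop :=
  PauliFrame {
    frame_herm : forall l, adjmx (P l) = P l;
    frame_sq : forall l, P l *m P l = 1%:M;
    frame_mul : forall l l', exists c l'', c != 0 /\ P l *m P l' = c *: P l'';
    frame_one : P e = 1%:M;
    frame_orth : forall l l', \tr (P l *m P l') = d%:R * (l == l')%:R;
    frame_card : #|L| = (d * d)%N }.

#[global] Arguments frame_herm {d L P e}.
#[global] Arguments frame_sq {d L P e}.
#[global] Arguments frame_mul {d L P e}.
#[global] Arguments frame_one {d L P e}.
#[global] Arguments frame_orth {d L P e}.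
#[global] Arguments frame_card {d L P e}.

Definition frame_mx {d} {L : finType} (P : L -> 'M[C]_d) :
  'M[C]_(#|L|, d * d) := \matrix_i mxvec (P (enum_val i)).

Lemma mxtrace_mulE {d} (A B : 'M[C]_d) : \tr (A *m B) = \sum_i \sum_j A i j * B j i.
Proof. by apply: eq_bigr => i _; rewrite mxE. Qed.

Section Theory.
Context {d : nat} {L : finType} {P : L -> 'M[C]_d} {e : L}.
Hypothesis (d_gt0 : (0 < d)%N) (FP : pauli_frame d L P e).

Let dnz : d%:R != 0 :> C. Proof. by rewrite pnatr_eq0 -lt0n. Qed.

Lemma frame_mx_free : row_free (frame_mx P).
Proof.
(* The Gram matrix of the frame for the trace inner product is [d] times the identity, so the
   rescaled adjoint is a right inverse. *)
apply/row_freeP; exists (d%:R^-1 *: adjmx (frame_mx P)).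
rewrite -scalemxAr; apply/matrixP => i j; rewrite !mxE.
rewrite sum_mxvec_index (_ : \sum_i _ = \tr (P (enum_val i) *m P (enum_val j))).
  by rewrite (frame_orth FP) mulrA mulVf // mul1r (inj_eq enum_val_inj).
rewrite mxtrace_mulE; apply: eq_bigr => a _; apply: eq_bigr => b _.
by rewrite !mxE !mxvecE -[in RHS](frame_herm FP (enum_val j)) !mxE.
Qed.

(** The frame is linearly independent and has [d * d] members, so it is a basis of the matrices;
    trace orthogonality then reads off each coefficient. *)
Lemma frame_expand (X : 'M[C]_d) :
  X = d%:R^-1 *: \sum_l \tr (P l *m X) *: P l.
Proof.
have fullP : row_full (frame_mx P).
  rewrite -col_leq_rank (eqP frame_mx_free).
  by rewrite (frame_card FP).
have /submxP [D XD] := submx_full (mxvec X) fullP.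
have XE : X = \sum_l D 0 (enum_rank l) *: P l.
  apply: (can_inj mxvecK); rewrite XD mulmx_sum_row linear_sum /=.
  rewrite (reindex enum_rank) /=; last first.
    by exists enum_val => x _; rewrite (enum_rankK, enum_valK).
  by apply: eq_bigr => l _; rewrite rowK enum_rankK linearZ.
rewrite {1}XE scaler_sumr; apply: eq_bigr => l _; rewrite scalerA; congr (_ *: _).
rewrite XE mulmx_sumr raddf_sum (bigD1 l) //= big1 ?addr0 => [|l' l'l].
  by rewrite -scalemxAr mxtraceZ (frame_orth FP) eqxx mulr1 mulrC mulfK.
by rewrite -scalemxAr mxtraceZ (frame_orth FP) eq_sym (negPf l'l) !mulr0.
Qed.

Lemma frame_parseval (X Y : 'M[C]_d) :
  \tr (X *m Y) = d%:R^-1 * \sum_l \tr (P l *m X) * \tr (P l *m Y).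
Proof.
rewrite {1}(frame_expand X) -scalemxAl mxtraceZ; congr (_ * _).
rewrite mulmx_suml raddf_sum; apply: eq_bigr => l _ /=.
by rewrite -scalemxAl mxtraceZ.
Qed.

(** Distinct proportional elements would make the trace of [P l *m P l] vanish, whereas it equals
    [d]. Hence labels name Paulis modulo phases faithfully. *)
Lemma frame_inj_scale c l l' : P l = c *: P l' -> l = l'.
Proof.
move=> Pll'; apply/eqP; apply/negPn/negP => ll'.
have := frame_orth FP l l; rewrite {2}Pll' -scalemxAr mxtraceZ.
rewrite (frame_orth FP) (negPf ll') eqxx !mulr0 mulr1 => /eqP.
by rewrite eq_sym (negPf dnz).
Qed.

End Theory.

Lemma frame_tens {d d'} {L L' : finType} {P : L -> 'M[C]_d} {P' : L' -> 'M[C]_d'} {e e'} :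
  pauli_frame d L P e -> pauli_frame d' L' P' e' ->
  pauli_frame (d * d') (L * L')%type (fun l => tensmx (P l.1) (P' l.2)) (e, e').
Proof.
move=> F F'; split => [l|l|l k||l k|].
- by rewrite adjmx_tens (frame_herm F) (frame_herm F').
- by rewrite tensmx_mul (frame_sq F) (frame_sq F') tensmx11.
- have [c [m [c0 Em]]] := frame_mul F l.1 k.1.
  have [c' [m' [c'0 E]]] := frame_mul F' l.2 k.2.
  exists (c * c'), (m, m'); split; first by rewrite mulf_neq0.
  by rewrite tensmx_mul Em E tensmxZl tensmxZr scalerA.
- by rewrite (frame_one F) (frame_one F') tensmx11.
- rewrite tensmx_mul mxtrace_tens (frame_orth F) (frame_orth F').
  by rewrite mulrACA -!natrM mulnb -xpair_eqE -!surjective_pairing.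
- by rewrite card_prod (frame_card F) (frame_card F') mulnACA.
Qed.

End Frame.

(** * The frame of Pauli strings and a state with no vanishing Pauli expectation *)

Section Qubits.
Context {R : realType}.
Local Notation C := R[i].

Lemma mx2P (A B : 'M[C]_2) :
  A 0 0 = B 0 0 -> A 0 1 = B 0 1 -> A 1 0 = B 1 0 -> A 1 1 = B 1 1 -> A = B.
Proof.
move=> h00 h01 h10 h11; apply/matrixP => i j.
have I2 (k : 'I_2) : k = 0 \/ k = 1.
  by case: k => -[|[|//]] hk; [left|right]; apply: val_inj.
by case: (I2 i) => ->; case: (I2 j) => ->.
Qed.

Lemma ord4P (Q : 'I_4 -> Prop) :
  Q (@Ordinal 4 0 isT) -> Q (@Ordinal 4 1 isT) ->
  Q (@Ordinal 4 2 isT) -> Q (@Ordinal 4 3 isT) ->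
  forall l, Q l.
Proof.
move=> q0 q1 q2 q3 [[|[|[|[|//]]]] hl].
- by rewrite (bool_irrelevance hl isT).
- by rewrite (bool_irrelevance hl isT).
- by rewrite (bool_irrelevance hl isT).
- by rewrite (bool_irrelevance hl isT).
Qed.

Let simp := (@mul0r C, @mulr0 C, @mul1r C, @mulr1 C, @mulrN C, @mulNr C, @addr0 C,
  @add0r C, @mulCii C, @opprK C, @oppr0 C, @subrr C, @addNr C).

Ltac pauli_entry :=
  by rewrite ?(mxE, big_ord_recl, big_ord0) /= ?rmorphN /= ?rmorph0 ?rmorph1
    ?conjCi ?simp.

Lemma pauli1_herm l : adjmx (pauli1 l) = pauli1 l :> 'M[C]_2.
Proof. by elim/ord4P: l; apply: mx2P; pauli_entry. Qed.

Lemma pauli1_sq l : pauli1 l *m pauli1 l = 1%:M :> 'M[C]_2.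
Proof. by elim/ord4P: l; apply: mx2P; pauli_entry. Qed.

Lemma pauli1_one : pauli1 ord0 = 1%:M :> 'M[C]_2.
Proof. by apply: mx2P; pauli_entry. Qed.

Lemma pauli1_mul l l' : exists (c : C) l'',
  c != 0 /\ pauli1 l *m pauli1 l' = c *: pauli1 l''.
Proof.
have i0 : 'i != 0 :> C by exact: neq0Ci.
have ni0 : - 'i != 0 :> C by rewrite oppr_eq0.
pose o1 := @Ordinal 4 1 isT; pose o2 := @Ordinal 4 2 isT.
pose o3 := @Ordinal 4 3 isT.
case: (eqVneq l ord0) => [->|l0].
  by exists 1, l'; rewrite oner_neq0 pauli1_one mul1mx scale1r.
case: (eqVneq l' ord0) => [->|l'0].
  by exists 1, l; rewrite oner_neq0 pauli1_one mulmx1 scale1r.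
case: (eqVneq l l') => [->|].
  by exists 1, ord0; rewrite oner_neq0 pauli1_one scale1r pauli1_sq.
elim/ord4P: l l0 => // _; elim/ord4P: l' l'0 => // _ _.
- by exists 'i, o3; split=> //; apply: mx2P; pauli_entry.
- by exists (- 'i), o2; split=> //; apply: mx2P; pauli_entry.
- by exists (- 'i), o3; split=> //; apply: mx2P; pauli_entry.
- by exists 'i, o1; split=> //; apply: mx2P; pauli_entry.
- by exists 'i, o2; split=> //; apply: mx2P; pauli_entry.
- by exists (- 'i), o1; split=> //; apply: mx2P; pauli_entry.
Qed.

Lemma pauli1_orth l l' : \tr (pauli1 l *m pauli1 l') = 2%:R * (l == l')%:R :> C.
Proof.
case: (eqVneq l l') => [->|]; first by rewrite pauli1_sq mxtrace1 mulr1.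
by elim/ord4P: l; elim/ord4P: l' => //= _; rewrite /mxtrace; pauli_entry.
Qed.

Lemma pauli1_frame : pauli_frame 2 'I_4 (@pauli1 R) ord0.
Proof.
split; [exact: pauli1_herm | exact: pauli1_sq | exact: pauli1_mul |
  exact: pauli1_one | exact: pauli1_orth | by rewrite card_ord].
Qed.

Lemma pauli1_generic_vec : exists psi : 'cV[C]_2, unit_vec psi /\
  forall l, \tr (adjmx psi *m pauli1 l *m psi) != 0.
Proof.
(* After normalization by [c], the Bloch vector is (2, 2, -1)/3, which has no zero coordinate. *)
pose v : 'cV[C]_2 := \col_i (if val i == 0%N then 1 else 1 + 'i).
pose c : C := (sqrtC 3%:R)^-1.
have ii : 'i * 'i = -1 :> C by exact: mulCii.
have vl l : \tr (adjmx v *m pauli1 l *m v) =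
    match val l with 0 => 3%:R | 1 => 2%:R | 2 => 2%:R | _ => -1 end.
  have t1 (A : 'M[C]_1) : \tr A = A 0 0 by rewrite /mxtrace big_ord1.
  by elim/ord4P: l; rewrite t1 ?(mxE, big_ord_recl, big_ord0) /=
    ?rmorphD ?rmorph1 /= ?conjCi; ring: ii.
have cc : c^* * c = 3%:R^-1.
  have cr : c^* = c by apply/conj_Creal/ger0_real; rewrite invr_ge0 sqrtC_ge0 ler0n.
  by rewrite cr /c -invfM -expr2 sqrtCK.
have n3 : 3%:R != 0 :> C by rewrite pnatr_eq0.
exists (c *: v); split=> [|l]; last first.
  rewrite adjmxZ -!scalemxAl -scalemxAr scalerA mxtraceZ vl cc mulf_neq0 ?invr_eq0 //.
  by elim/ord4P: l; rewrite /= ?pnatr_eq0 ?oppr_eq0 ?oner_eq0.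
rewrite /unit_vec [LHS]mx11_scalar -trace_mx11 adjmxZ -scalemxAl -scalemxAr scalerA.
by rewrite mxtraceZ cc -[adjmx v]mulmx1 -pauli1_one vl mulVf.
Qed.

Lemma frame_cast {d d'} (E : d = d') {L : finType} {P : L -> 'M[C]_d} {e} :
  pauli_frame d L P e -> pauli_frame d' L (fun l => castmx (E, E) (P l)) e.
Proof.
case: d' / E => -[h s m o t k].
by split=> *; rewrite ?castmx_id.
Qed.

(** Induction on the qubits by tensor products. A finite type of labels replaces the functions
    [nat -> 'I_4], so that stabilizer elements can be counted; the product vector [psi] later makes
    the POVM informationally complete. *)
Lemma pauli_str_frame n : exists (L : finType) (P : L -> 'M[C]_(2 ^ n)) (e : L),
  [/\ pauli_frame (2 ^ n) L P e,
      forall s, exists l, P l = pauli_str n s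
    & exists psi : 'cV[C]_(2 ^ n), unit_vec psi /\
        forall l, \tr (adjmx psi *m P l *m psi) != 0].
Proof.
elim: n => [|n [L [P [e [FP Ps [psi [psi1 psiP]]]]]]].
  exists unit, (fun=> 1%:M), tt; split; last 1 first.
  - exists 1%:M.
    have a1 : adjmx (1%:M : 'M[C]_1) = 1%:M by rewrite /adjmx trmx1 map_mx1.
    by split=> [|l]; rewrite /unit_vec a1 !mul1mx // mxtrace1 oner_neq0.
  - split=> *; rewrite ?card_unit ?mulmx1 ?mxtrace1 ?mulr1 //.
      by rewrite /adjmx trmx1 map_mx1.
    by exists 1, tt; rewrite oner_neq0 scale1r.
  by move=> s; exists tt.
have [psi' [psi'1 psi'P]] := pauli1_generic_vec.
exists ('I_4 * L)%type, (fun l => castmx (esym (expnS 2 n), esym (expnS 2 n))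
  (tensmx (pauli1 l.1) (P l.2))), (ord0, e); split.
- exact: frame_cast (frame_tens pauli1_frame FP).
- by move=> s; have [l Pl] := Ps s; exists (s n, l); rewrite /= Pl.
exists (castmx (esym (expnS 2 n), muln1 1) (tensmx psi' psi)).
rewrite /unit_vec adjmx_cast adjmx_tens.
(* Generalizing the dimension [2 ^ n.+1] lets its cast be eliminated. *)
move: (esym _); move: (2 ^ n.+1)%N => k; case: k /; move: (muln1 1) => E.
rewrite -castmx_mul tensmx_mul psi1 psi'1 tensmx11; split=> [|l].
  by apply/matrixP => i j; rewrite castmxE !mxE -!val_eqE.
rewrite castmx_id -{1}[pauli1 l.1 *t P l.2](castmx_id (erefl, erefl)) -!castmx_mul.
rewrite mxtrace_castmx !tensmx_mul mxtrace_tens mulf_neq0 //.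
Qed.

End Qubits.

(** * Stabilizer groups *)

Section Stabilizer.
Context {R : realType}.
Local Notation C := R[i].

Definition expct {d} {L : finType} (P : L -> 'M[C]_d) (v : 'cV[C]_d) l : C :=
  \tr (P l *m (v *m adjmx v)).

(* The stabilizer group modulo phases, as a set of labels. *)
Definition stab {d} {L : finType} (P : L -> 'M[C]_d) {B : finType} (Phi : B -> 'cV[C]_d) :
  {set L} := [set l | [forall b, P l *m Phi b == expct P (Phi b) l *: Phi b]].

Lemma unit_vec_trace {d} (v : 'cV[C]_d) : unit_vec v -> \tr (v *m adjmx v) = 1.
Proof. by rewrite mxtrace_mulC => ->; rewrite mxtrace1. Qed.

Lemma unit_vec_proj {d} (v : 'cV[C]_d) : unit_vec v ->
  v *m adjmx v *m (v *m adjmx v) = v *m adjmx v.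
Proof. by move=> v1; rewrite mulmxA -(mulmxA v) v1 mulmx1. Qed.

Lemma eigen_trace {d} (A : 'M[C]_d) (v : 'cV[C]_d) c :
  unit_vec v -> A *m v = c *: v -> c = \tr (A *m (v *m adjmx v)).
Proof. by move=> v1 Av; rewrite mulmxA Av -scalemxAl mxtraceZ unit_vec_trace ?mulr1. Qed.

(** The square matrix with columns [Phi b] has its adjoint as left inverse, hence also as right
    inverse. *)
Lemma orthonormal_complete {d} (Phi : 'I_d -> 'cV[C]_d) :
  (forall b b', adjmx (Phi b) *m Phi b' = ((b == b')%:R)%:M) ->
  \sum_b Phi b *m adjmx (Phi b) = 1%:M.
Proof.
move=> ortho; pose U : 'M[C]_d := \matrix_(i, b) Phi b i 0.
have UU : adjmx U *m U = 1%:M.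
  apply/matrixP => b b'; rewrite !mxE.
  have /matrixP/(_ 0 0) := ortho b b'; rewrite !mxE mulr1n => <-.
  by apply: eq_bigr => i _; rewrite !mxE.
rewrite -(mulmx1C UU); apply/matrixP => i j; rewrite summxE !mxE.
by apply: eq_bigr => b _; rewrite !mxE big_ord1 !mxE.
Qed.

Section FrameState.
Context {d : nat} {L : finType} {P : L -> 'M[C]_d} {e : L}.
Hypothesis (d_gt0 : (0 < d)%N) (FP : pauli_frame d L P e).

Let dnz : d%:R != 0 :> C. Proof. by rewrite pnatr_eq0 -lt0n. Qed.

(** The expectation of a Hermitian matrix is real, so its square is nonnegative in the partial order
    of [C]. *)
Lemma expct_ge0 v l : 0 <= expct P v l ^+ 2.
Proof.
suff Tr : (expct P v l)^* = expct P v l by rewrite expr2 -{2}Tr mul_conjC_ge0.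
by rewrite /expct -mxtrace_adj !adjmxM adjmxK (frame_herm FP) mxtrace_mulC.
Qed.

Lemma eigen_sq v l c : unit_vec v -> P l *m v = c *: v -> c ^+ 2 = 1.
Proof.
move=> v1 Pv; have := eigen_trace (P l *m P l) v (c ^+ 2) v1.
rewrite -mulmxA Pv -scalemxAr Pv scalerA => /(_ erefl) ->.
by rewrite (frame_sq FP) mul1mx unit_vec_trace.
Qed.

(** Parseval for the projector on [v], whose purity is 1. *)
Lemma sum_expct_sq v : unit_vec v -> \sum_l expct P v l ^+ 2 = d%:R.
Proof.
move=> v1; have := frame_parseval d_gt0 FP (v *m adjmx v) (v *m adjmx v).
rewrite unit_vec_proj // unit_vec_trace // => /(congr1 (fun x => d%:R * x)).
by rewrite mulr1 mulVKf // => ->.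
Qed.

Section Stab.
Context {B : finType} {Phi : B -> 'cV[C]_d}.
Hypothesis Phi1 : forall b, unit_vec (Phi b).
Local Notation G := (stab P Phi).

Lemma stabP l : reflect (forall b, P l *m Phi b = expct P (Phi b) l *: Phi b) (l \in G).
Proof. by rewrite inE; apply: (iffP forallP) => h b; apply/eqP. Qed.

Lemma eigen_stab l : (forall b, exists c, P l *m Phi b = c *: Phi b) -> l \in G.
Proof.
move=> h; apply/stabP => b; have [c Pc] := h b.
by rewrite Pc /expct -(eigen_trace _ _ _ (Phi1 b) Pc).
Qed.

Lemma stab_mul l l' l'' c : l \in G -> l' \in G -> c != 0 ->
  P l *m P l' = c *: P l'' -> l'' \in G.
Proof.
move=> /stabP lG /stabP l'G c0 Pll; apply: eigen_stab => b.
exists (c^-1 * expct P (Phi b) l' * expct P (Phi b) l).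
apply: (scalerI c0); rewrite scalemxAl -Pll -mulmxA l'G -scalemxAr lG !scalerA.
by congr (_ *: _); field.
Qed.

Lemma expct_stab b l : l \in G -> expct P (Phi b) l ^+ 2 = 1.
Proof. by move=> /stabP/(_ b)/(eigen_sq _ _ _ (Phi1 b)). Qed.

(* Parseval gives total squared weight d, and G already accounts for |G| of it. *)
Lemma stab_max b : (d <= #|G|)%N ->
  #|G| = d /\ forall l, l \notin G -> expct P (Phi b) l = 0.
Proof.
move=> dG; have := sum_expct_sq _ (Phi1 b).
rewrite (bigID (mem G)) /= (eq_bigr (fun=> 1)) => [|l lG]; last exact: expct_stab.
rewrite sumr_const => sumE.
have s0 : 0 <= \sum_(l | l \notin G) expct P (Phi b) l ^+ 2.
  by apply: sumr_ge0 => l _; exact: expct_ge0.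
have Gd : #|G| = d.
  apply/eqP; rewrite eqn_leq dG andbT.
  by rewrite -(ler_nat C) -sumE lerDl.
split=> // l lG; move: sumE; rewrite Gd => /eqP.
rewrite -[X in _ == X]addr0 (inj_eq (addrI _)) psumr_eq0 => [|k _]; last exact: expct_ge0.
by move=> /allP/(_ l); rewrite mem_index_enum lG sqrf_eq0 => /(_ isT)/eqP.
Qed.

End Stab.

(** The products of the [2 ^ k] subsets of generators are pairwise distinct modulo phases: if two
    agreed, the product over the symmetric difference of the subsets would be a scalar, against
    independence. *)
Lemma stab_card_generators {k} {Phi : 'I_d -> 'cV[C]_d} {g : 'I_k -> 'M[C]_d} :
  (forall b b', adjmx (Phi b) *m Phi b' = ((b == b')%:R)%:M) ->
  (forall i, exists c l, c != 0 /\ g i = c *: P l) ->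
  (forall S : {set 'I_k}, S != set0 ->
     ~~ is_scalar_mx (\big[@mulmx C d d d/1%:M]_(i in S) g i)) ->
  (forall i b, exists lam, g i *m Phi b = lam *: Phi b) ->
  (2 ^ k <= #|stab P Phi|)%N.
Proof.
move=> ortho gP indep eig.
have Phi1 b : unit_vec (Phi b) by rewrite /unit_vec ortho eqxx.
pose lam i b := \tr (g i *m (Phi b *m adjmx (Phi b))).
have lamP i b : g i *m Phi b = lam i b *: Phi b.
  by have [c gc] := eig i b; rewrite gc /lam -(eigen_trace _ _ _ (Phi1 b) gc).
(* The phase of [g i] may be imaginary, so its eigenvalues need not be 1 or -1; but their square is
   the squared phase, the same for every [b]. *)
have [kap kapP] : exists kap : 'I_k -> C,
    forall i, kap i != 0 /\ forall b, lam i b ^+ 2 = kap i.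
  apply: (@fin_all_exists _ (fun=> C)
    (fun i c => c != 0 /\ forall b, lam i b ^+ 2 = c)) => i.
  have [c [l [c0 gi]]] := gP i; exists (c ^+ 2); split=> [|b]; first by rewrite expf_neq0.
  have Pe : P l *m Phi b = (c^-1 * lam i b) *: Phi b.
    by rewrite -scalerA -lamP gi -scalemxAl scalerK.
  by have := eigen_sq _ _ _ (Phi1 b) Pe; rewrite exprMn exprVn => /(canRL (mulVKf _)) ->;
    rewrite ?mulr1 ?expf_neq0.
have lam0 i b : lam i b != 0.
  by have [k0 /(_ b) kE] := kapP i; rewrite -sqrf_eq0 kE.
pose gS (S : {set 'I_k}) := \big[@mulmx C d d d/1%:M]_(i in S) g i.
have gSP S b : gS S *m Phi b = (\prod_(i in S) lam i b) *: Phi b.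
  apply: (big_rec2 (fun (X : 'M[C]_d) y => X *m Phi b = y *: Phi b)).
    by rewrite mul1mx scale1r.
  by move=> i y X _ XP; rewrite -mulmxA XP -scalemxAr lamP scalerA mulrC.
have [f fP] : exists f : {set 'I_k} -> L,
    forall S, exists c, c != 0 /\ gS S = c *: P (f S).
  apply: (@fin_all_exists _ (fun=> L)
    (fun S l => exists c, c != 0 /\ gS S = c *: P l)) => S.
  apply: (big_ind (fun X => exists l c, c != 0 /\ X = c *: P l)) => [|X Y|i _].
  - by exists e, 1; rewrite oner_neq0 (frame_one FP) scale1r.
  - move=> [l [c [c0 ->]]] [l' [c' [c'0 ->]]].
    have [c'' [l'' [c''0 E]]] := frame_mul FP l l'.
    exists l'', (c * c' * c''); split; first by rewrite !mulf_neq0.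
    by rewrite -scalemxAl -scalemxAr E !scalerA.
  - by have [c [l ?]] := gP i; exists l, c.
have fstab S : f S \in stab P Phi.
  apply: eigen_stab => // b; have [c [c0 gc]] := fP S.
  exists (c^-1 * \prod_(i in S) lam i b).
  by rewrite -scalerA -gSP gc -scalemxAl scalerK.
have f_inj : injective f.
  move=> S S' fSS; apply/eqP/negPn/negP => SS.
  pose D := (S :\: S') :|: (S' :\: S).
  have D0 : D != set0.
    apply: contraNneq SS => /eqP; rewrite setU_eq0 !setD_eq0 => /andP[h h'].
    by rewrite eqEsubset h.
  have [c [c0 gc]] := fP S; have [c' [c'0 gc']] := fP S'.
  have gSS : gS S = (c / c') *: gS S'.
    by rewrite gc gc' fSS scalerA mulfVK.
  have /negP := indep _ D0; apply.
  (* Cancelling the eigenvalues over the intersection in [prodS] leaves the product over [S :\: S']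
     equal to [c / c'] times that over [S' :\: S]; multiplying by the latter produces the squares
     [kap i], so [K] is independent of [b]. *)
  pose K := c / c' * \prod_(i in S' :\: S) kap i.
  suff DK b : \prod_(i in D) lam i b = K.
    apply/is_scalar_mxP; exists K.
    (* Completeness turns a common eigenvalue on all basis vectors into an operator identity. *)
    rewrite -[LHS]mulmx1 -[X in _ *m X](orthonormal_complete _ ortho) mulmx_sumr.
    rewrite (eq_bigr (fun b => K *: (Phi b *m adjmx (Phi b)))) => [|b _].
      by rewrite -scaler_sumr (orthonormal_complete _ ortho) scalemx1.
    by rewrite -/(gS D) mulmxA gSP DK scalemxAl.
  have prodS : \prod_(i in S) lam i b = c / c' * \prod_(i in S') lam i b.
    rewrite (eigen_trace _ _ _ (Phi1 b) (gSP S b)) gSS -scalemxAl mxtraceZ.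
    by rewrite -(eigen_trace _ _ _ (Phi1 b) (gSP S' b)).
  have disj : [disjoint S :\: S' & S' :\: S].
    by rewrite -setI_eq0; apply/eqP/setP => i; rewrite !inE;
      case: (i \in S); rewrite ?andbF.
  rewrite (eq_bigl [predU S :\: S' & S' :\: S]) => [|i]; last by rewrite !inE.
  rewrite bigU //= /K -(eq_bigr _ (fun i _ => (kapP i).2 b)) prodrXl.
  move: prodS; rewrite (big_setID S') /= [in RHS](big_setID S) /= setIC mulrCA.
  move=> /mulfI -> //; first by rewrite expr2 mulrA.
  by apply/prodf_neq0 => i _.
have -> : (2 ^ k = #|[set: {set 'I_k}]|)%N.
  by rewrite -powersetT card_powerset cardsT card_ord.
rewrite -(card_imset _ f_inj); apply/subset_leq_card/subsetP => _ /imsetP[S _ ->].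
exact: fstab.
Qed.

End FrameState.
End Stabilizer.

(** * Marginals of a stabilizer basis *)

Section Bipartite.
Context {R : realType}.
Local Notation C := R[i].

(** The coefficient matrix M of a bipartite vector, as in the Schmidt decomposition: local operators
    act on its two sides, and the reduced state on the first factor is M times its adjoint. *)
Definition unvec {dA dB} (v : 'cV[C]_(dA * dB)) : 'M[C]_(dA, dB) :=
  \matrix_(i, j) v (mxtens_index (i, j)) 0.

Lemma unvec_tens {dA dB} (A : 'M[C]_dA) (B : 'M[C]_dB) v :
  unvec (tensmx A B *m v) = A *m unvec v *m B^T.
Proof.
apply/matrixP => i j; rewrite !mxE sum_mxtens_index exchange_big /=.
apply: eq_bigr => j' _; rewrite !mxE mulr_suml; apply: eq_bigr => i' _.
by rewrite tensmxE !mxE mulrAC.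
Qed.

Lemma mxtrace_unvec {dA dB} (v w : 'cV[C]_(dA * dB)) :
  \tr (w *m adjmx v) = \tr (unvec w *m adjmx (unvec v)).
Proof.
rewrite /mxtrace sum_mxtens_index; apply: eq_bigr => i _; rewrite mxE.
by apply: eq_bigr => j _; rewrite !mxE big_ord1 !mxE.
Qed.

Section FramePair.
Context {dA dB : nat} {LA LB : finType} {PA : LA -> 'M[C]_dA} {PB : LB -> 'M[C]_dB}.
Context {eA : LA} {eB : LB}.
Hypotheses (dA0 : (0 < dA)%N) (dB0 : (0 < dB)%N).
Hypotheses (FA : pauli_frame dA LA PA eA) (FB : pauli_frame dB LB PB eB).
Local Notation P := (fun l : LA * LB => tensmx (PA l.1) (PB l.2)).
Let FAB := frame_tens FA FB.
Let dAB0 : (0 < dA * dB)%N. Proof. by rewrite muln_gt0 dA0. Qed.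

Lemma expct_unvec v l :
  expct P v l = \tr (PA l.1 *m unvec v *m (PB l.2)^T *m adjmx (unvec v)).
Proof. by rewrite /expct mulmxA mxtrace_unvec unvec_tens. Qed.

Lemma expct_left v s :
  expct P v (s, eB) = \tr (PA s *m (unvec v *m adjmx (unvec v))).
Proof. by rewrite expct_unvec (frame_one FB) trmx1 mulmx1 mulmxA. Qed.

(* Both sides are the purity of a reduced state of v, up to the factor dA * dB. *)
Lemma purity_eq v :
  dB%:R * \sum_s expct P v (s, eB) ^+ 2 = dA%:R * \sum_t expct P v (eA, t) ^+ 2.
Proof.
have nA : dA%:R != 0 :> C by rewrite pnatr_eq0 -lt0n.
have nB : dB%:R != 0 :> C by rewrite pnatr_eq0 -lt0n.
(* [X] and [Y] are the reduced states of [v] on the two factors; their purities agree by cyclicity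
   of the trace. *)
set M := unvec v; pose X := M *m adjmx M; pose Y := (adjmx M *m M)^T.
have -> : \sum_s expct P v (s, eB) ^+ 2 = dA%:R * \tr (X *m X).
  rewrite (frame_parseval dA0 FA) mulVKf //; apply: eq_bigr => s _.
  by rewrite expct_left.
have -> : \sum_t expct P v (eA, t) ^+ 2 = dB%:R * \tr (Y *m Y).
  rewrite (frame_parseval dB0 FB) mulVKf //; apply: eq_bigr => t _.
  rewrite expct_unvec (frame_one FA) mul1mx /= -/M.
  rewrite -[\tr (PB t *m Y)]mxtrace_tr trmx_mul trmxK.
  by rewrite -mulmxA mxtrace_mulC -mulmxA mxtrace_mulC.
have -> : \tr (Y *m Y) = \tr (X *m X).
  by rewrite -trmx_mul mxtrace_tr mulmxA mxtrace_mulC !mulmxA.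
by rewrite mulrCA.
Qed.

Section Marginals.
Context {B : finType} {Phi : B -> 'cV[C]_(dA * dB)}.
Hypothesis Phi1 : forall b, unit_vec (Phi b).
Local Notation G := (stab P Phi).

Definition stabA : {set LA} := [set s | (s, eB) \in G].
Definition stabB : {set LB} := [set t | (eA, t) \in G].
Definition stab_proj : {set LA} := [set l.1 | l in G].

(** Each fibre of the projection of G to its data factor is a coset of [stabB]. Labels carry no
    group law, so translation by a fixed element [(s', t0)] of the fibre is realized by an injection
    [f] on labels. *)
Lemma card_stab_proj : #|G| = (#|stab_proj| * #|stabB|)%N.
Proof.
rewrite -sum1_card (partition_big fst (mem stab_proj)) /= => [|l lG]; last first.
  by apply/imsetP; exists l.
rewrite -sum_nat_const; apply: eq_bigr => s /imsetP[[s' t0] lG /= ->{s}].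
rewrite (eq_bigl (mem [set l in G | l.1 == s'])); last by move=> l; rewrite !inE.
rewrite sum1_card.
have [f fP] : exists f : LB -> LB,
    forall t, exists c, c != 0 /\ PB t0 *m PB t = c *: PB (f t).
  apply: (@fin_all_exists _ (fun=> LB)
    (fun t l => exists c, c != 0 /\ PB t0 *m PB t = c *: PB l)) => t.
  by have [c [l ?]] := frame_mul FB t0 t; exists l, c.
have f_inj : injective f.
  move=> t t' ff; have [c [c0 E]] := fP t; have [c' [c'0 E']] := fP t'.
  apply: (frame_inj_scale dB0 FB (c / c')).
  rewrite -[PB t]mul1mx -[PB t']mul1mx -(frame_sq FB t0) -!mulmxA E E' ff.
  by rewrite -!scalemxAr scalerA mulfVK.
apply/eqP; rewrite eqn_leq; apply/andP; split.
(* Translation by [(s', t0)] sends the fibre into [stabB], because [PA s'] squares to the identity;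
   the other bullet translates [stabB] back into the fibre. *)
- pose h (l : LA * LB) := f l.2.
  rewrite -(card_in_imset (f := h)) => [|[s t] [s'' t']]; last first.
    by move=> /setIdP[_ /eqP/= ->] /setIdP[_ /eqP/= ->] /f_inj/= ->.
  apply/subset_leq_card/subsetP => _ /imsetP[[s t] + ->].
  move=> /setIdP[lG' /eqP/= ss]; rewrite ss in lG'.
  have [c [c0 E]] := fP t.
  rewrite in_set /h /=; apply: (stab_mul Phi1 (s', t0) (s', t) (eA, f t) c) => //=.
  by rewrite tensmx_mul E (frame_sq FA) (frame_one FA) tensmxZr.
- rewrite -(card_imset _ (f := fun t => (s', f t))) => [|t t' [/f_inj] //].
  apply/subset_leq_card/subsetP => _ /imsetP[t + ->].
  rewrite [t \in _]in_set => lG'; apply/setIdP; split=> //=.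
  have [c [c0 E]] := fP t.
  apply: (stab_mul Phi1 (s', t0) (eA, t) (s', f t) c) => //=.
  by rewrite tensmx_mul E (frame_one FA) mulmx1 tensmxZr.
Qed.

Hypothesis Gbig : (dA * dB <= #|G|)%N.

Lemma sum_expct_left b : \sum_s expct P (Phi b) (s, eB) ^+ 2 = #|stabA|%:R.
Proof.
have [_ T0] := stab_max dAB0 FAB Phi1 b Gbig.
rewrite -sum1_card natr_sum [RHS]big_mkcond /=; apply: eq_bigr => s _.
rewrite [s \in _]inE; case: ifPn => [/(expct_stab FAB Phi1 b)//|/T0 ->].
by rewrite expr0n.
Qed.

Lemma sum_expct_right b : \sum_t expct P (Phi b) (eA, t) ^+ 2 = #|stabB|%:R.
Proof.
have [_ T0] := stab_max dAB0 FAB Phi1 b Gbig.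
rewrite -sum1_card natr_sum [RHS]big_mkcond /=; apply: eq_bigr => t _.
rewrite [t \in _]inE; case: ifPn => [/(expct_stab FAB Phi1 b)//|/T0 ->].
by rewrite expr0n.
Qed.

Lemma card_stabA_stabB (b : B) : (dB * #|stabA| = dA * #|stabB|)%N.
Proof.
apply/eqP; rewrite -(eqr_nat C) !natrM -(sum_expct_left b) -(sum_expct_right b).
by rewrite purity_eq.
Qed.

(** The Pauli expansion of [rho] contains only the elements of [stabA], each with its stabilizer
    eigenvalue as coefficient. Each such term fixes [rho] under multiplication, so [rho *m rho]
    counts them. *)
Lemma reduced_state_sq b (rho := unvec (Phi b) *m adjmx (unvec (Phi b))) :
  rho *m rho = (#|stabA|%:R / dA%:R) *: rho.
Proof.
have [_ T0] := stab_max dAB0 FAB Phi1 b Gbig.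
rewrite {1}(frame_expand dA0 FA rho) -scalemxAl mulmx_suml.
rewrite mulrC -scalerA; congr (_ *: _).
rewrite -(sum_expct_left b) scaler_suml; apply: eq_bigr => s _.
rewrite -scalemxAl /rho -expct_left.
have [sG|/T0 ->] := boolP ((s, eB) \in G); last by rewrite expr0n !scale0r.
rewrite expr2 -scalerA; congr (_ *: _).
(* In matrix form, the stabilizer equation says that [PA s] multiplies [unvec (Phi b)] by the
   eigenvalue. *)
have /stabP/(_ b)/(congr1 unvec) := sG.
rewrite unvec_tens /= (frame_one FB) trmx1 mulmx1 => E.
rewrite mulmxA E scalemxAl; congr (_ *m _).
by apply/matrixP => i j; rewrite !mxE.
Qed.

End Marginals.
End FramePair.
End Bipartite.

(** * Entropy of a state with flat spectrum *)

Section Entropy.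
Context {R : realType}.
Local Notation C := R[i].

(* The spectrum of rho lies in {0, k/d}, so the entropy is - log2 (k/d). *)
Lemma flat_entropy {d p k : nat} {rho : 'M[C]_d} : (0 < d)%N ->
  \tr rho = 1 -> rho *m rho = (k%:R / d%:R) *: rho ->
  vN_entropy_is rho p%:R -> (k * 2 ^ p = d)%N.
Proof.
move=> d0 tr1 rho2 [rs [rsE pE]].
have dnz (F : numFieldType) : d%:R != 0 :> F by rewrite pnatr_eq0 -lt0n.
have sz : size rs = d.
  by apply: succn_inj; rewrite -(size_char_poly rho) rsE size_prod_XsubC.
have sum1 : \sum_(r <- rs) r = 1.
  (* The coefficient of degree [d - 1] of the characteristic polynomial is minus the trace, and also
     minus the sum of the roots. *)
  apply: oppr_inj; rewrite -[in RHS]tr1 -(char_poly_trace _ d0) rsE -{1}sz.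
  by rewrite -coefPn_prod_XsubC // sz -lt0n.
pose q : R := k%:R / d%:R.
have qC : k%:R / d%:R = (q%:C)%C :> C by rewrite rmorphM fmorphV !rmorph_nat.
have rsP r : r \in rs -> r = 0 \/ r = (q%:C)%C.
  move=> rrs; have : root (char_poly rho) r by rewrite rsE root_prod_XsubC.
  rewrite -eigenvalue_root_char => /eigenvalueP[v vr v0].
  have /eqP : (r * (r - (q%:C)%C)) *: v = 0.
    have : v *m rho *m rho = (r * r) *: v by rewrite vr -scalemxAl vr scalerA.
    rewrite -mulmxA rho2 qC -scalemxAr vr scalerA mulrBr scalerBl => <-.
    by rewrite mulrC subrr.
  rewrite scaler_eq0 (negPf v0) orbF mulf_eq0 subr_eq0.
  by case/orP => /eqP; [left|right].
have q0 : q != 0.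
  apply: contra_eq_neq sum1 => q0; rewrite big_seq big1 ?(eq_sym 0) ?oner_neq0 // => r.
  by case/rsP => -> //; rewrite q0.
have qgt0 : 0 < q by rewrite lt0r q0 divr_ge0 ?ler0n.
have ln2 : ln 2 != 0 :> R by apply/lt0r_neq0/ln_gt0; rewrite ltr1n.
(* On the values 0 and [q], [xlog2] agrees with a linear function, the convention at 0 included; the
   entropy is then read off from the trace. *)
have xlogE r : r \in rs -> xlog2 (complex.Re r) = complex.Re r * (ln q / ln 2).
  case/rsP => ->; rewrite /xlog2 /=; first by rewrite eqxx mul0r.
  by rewrite (negPf q0) mulrA.
have {pE} : (p%:R : R) = - (ln q / ln 2).
  rewrite pE big_seq (eq_bigr _ xlogE) -big_seq -mulr_suml.
  rewrite -(raddf_sum (@complex.Re R)) /=.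
  by rewrite sum1 mul1r.
move=> /(congr1 (fun x => - x * ln 2)); rewrite opprK mulfVK // mulNr => pln.
have /ln_inj : ln ((2 ^+ p)^-1) = ln q :> R.
  by rewrite lnV ?posrE ?exprn_gt0 ?ltr0n // lnXn ?ltr0n // -pln mulr_natl.
rewrite !posrE invr_gt0 exprn_gt0 ?ltr0n // => /(_ isT qgt0) qE.
apply/eqP; rewrite -(eqr_nat R) natrM natrX; apply/eqP.
have -> : k%:R = q * d%:R :> R by rewrite /q mulfVK ?dnz.
by rewrite -qE mulrAC mulVf ?mul1r // expf_neq0 // pnatr_eq0.
Qed.

End Entropy.

(** * The span of the POVM *)

Section Ancilla.
Context {R : realType}.
Local Notation C := R[i].
Context {n m : nat}.

Lemma anc_bra_tens (psi : 'cV[C]_(2 ^ m)) (A : 'M[C]_(2 ^ n)) (B : 'M[C]_(2 ^ m)) :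
  anc_bra n m psi *m tensmx A B *m adjmx (anc_bra n m psi) =
  \tr (adjmx psi *m B *m psi) *: A.
Proof.
rewrite /anc_bra adjmx_cast adjmx_tens adjmxK.
rewrite (_ : adjmx (1%:M : 'M[C]__) = 1%:M); last by rewrite /adjmx trmx1 map_mx1.
rewrite -{1}[tensmx A B](castmx_id (erefl, erefl)) -!castmx_mul !tensmx_mul.
rewrite mul1mx mulmx1 [adjmx psi *m B *m psi in LHS]mx11_scalar -trace_mx11.
by rewrite tens_mx_scalar castmx_comp castmx_id.
Qed.

(** Contracting the ancilla with a bra sums the columns of the coefficient matrix with conjugated
    weights; for a basis vector this selects one column, which yields the partial trace below. *)
Lemma anc_bra_unvec psi (v : 'cV[C]_(2 ^ n * 2 ^ m)) :
  anc_bra n m psi *m v = unvec v *m map_mx Num.conj psi.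
Proof.
apply/matrixP => i k; rewrite !mxE sum_mxtens_index.
rewrite (bigD1 i) //= [X in _ + X]big1 ?addr0 => [|i' i'i].
  apply: eq_bigr => j _; rewrite castmxE /=.
  rewrite (_ : cast_ord _ i = mxtens_index (i, 0)); last first.
    by apply: val_inj; rewrite /= muln1 addn0.
  by rewrite cast_ord_id tensmxE !mxE eqxx mul1r !ord1 mulrC.
apply: big1 => j _; rewrite castmxE /=.
rewrite (_ : cast_ord _ i = mxtens_index (i, 0)); last first.
  by apply: val_inj; rewrite /= muln1 addn0.
by rewrite cast_ord_id tensmxE !mxE eq_sym (negPf i'i) !mul0r.
Qed.

Lemma ptrace_anc_unvec (v : 'cV[C]_(2 ^ n * 2 ^ m)) :
  ptrace_anc n m (v *m adjmx v) = unvec v *m adjmx (unvec v).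
Proof.
apply/matrixP => i k; rewrite /ptrace_anc summxE [RHS]mxE; apply: eq_bigr => j _.
rewrite mulmxA -mulmxA -adjmxM anc_bra_unvec.
have -> : map_mx Num.conj (delta_mx j 0 : 'cV[C]_(2 ^ m)) = delta_mx j 0.
  by apply/matrixP => a b; rewrite !mxE rmorph_nat.
by rewrite -colE mxE big_ord1 !mxE.
Qed.

Section SpanMu.
Context {LA LB : finType} {PA : LA -> 'M[C]_(2 ^ n)} {PB : LB -> 'M[C]_(2 ^ m)}.
Context {eA : LA} {eB : LB}.
Hypotheses (FA : pauli_frame (2 ^ n) LA PA eA) (FB : pauli_frame (2 ^ m) LB PB eB).
Local Notation P := (fun l : LA * LB => tensmx (PA l.1) (PB l.2)).
Context {Phi : 'I_(2 ^ n * 2 ^ m) -> 'cV[C]_(2 ^ n * 2 ^ m)}.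
Hypothesis ortho : forall b b', adjmx (Phi b) *m Phi b' = ((b == b')%:R)%:M.
Local Notation G := (stab P Phi).
Hypothesis Gbig : (2 ^ n * 2 ^ m <= #|G|)%N.
Local Notation proj := (@stab_proj R _ _ _ _ PA PB _ Phi).

Let Phi1 b : unit_vec (Phi b). Proof. by rewrite /unit_vec ortho eqxx. Qed.
Let dAB0 : (0 < 2 ^ n * 2 ^ m)%N. Proof. by rewrite muln_gt0 !expn_gt0. Qed.

(** Only elements of G occur in the Pauli expansion of the projector on [Phi b], and sandwiching
    with [psi] keeps a multiple of their data factors. *)
Lemma s_mu_le psi : (s_mu n m psi Phi <= #|proj|)%N.
Proof.
have FAB := frame_tens FA FB.
apply: (@leq_trans (\rank (\matrix_(i < #|proj|) mxvec (PA (enum_val i))))); last first.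
  exact: rank_leq_row.
apply/mxrankS/row_subP => b; rewrite rowK.
have [_ T0] := stab_max dAB0 FAB Phi1 b Gbig.
rewrite /povm_elt (frame_expand dAB0 FAB (Phi b *m adjmx (Phi b))).
rewrite -scalemxAr -scalemxAl linearZ scalemx_sub //=.
rewrite mulmx_sumr mulmx_suml linear_sum summx_sub // => l _ /=.
rewrite -scalemxAr -scalemxAl anc_bra_tens !linearZ /=.
have [lG|/T0 Tl] := boolP (l \in G); last first.
  by rewrite -/(expct P (Phi b) l) Tl scale0r sub0mx.
rewrite !scalemx_sub //.
have lp : l.1 \in proj by apply/imsetP; exists l.
rewrite -(enum_rankK_in lp lp).
by apply: (eq_row_sub (enum_rank_in lp l.1)); rewrite rowK.
Qed.

(** For [(s, t)] in G, dividing the sandwiched Pauli by the nonzero expectation of [PB t] recovers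
    [PA s]; so the span contains the whole data frame. *)
Lemma s_mu_full psi : (forall t, \tr (adjmx psi *m PB t *m psi) != 0) ->
  (forall s, s \in proj) -> s_mu n m psi Phi = (4 ^ n)%N.
Proof.
move=> psi0 projT; rewrite (_ : (4 ^ n = 2 ^ n * 2 ^ n)%N); last by rewrite -expnMn.
apply/eqP; rewrite eqn_leq rank_leq_col /=.
rewrite -(frame_card FA) -(eqP (frame_mx_free _ FA)) ?expn_gt0 //.
apply/mxrankS/row_subP => i; rewrite rowK; set s := enum_val i.
have /imsetP[[s' t] /stabP/= lG ->] := projT s.
rewrite -[PA s'](scalerK (psi0 t)) -anc_bra_tens linearZ scalemx_sub //=.
(* Inserting the resolution of the identity writes the stabilizer element as a combination of the
   basis projectors, hence its sandwich as one of the POVM elements. *)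
rewrite -[tensmx _ _]mulmx1 -(orthonormal_complete _ ortho) mulmx_sumr.
rewrite mulmx_sumr mulmx_suml linear_sum summx_sub // => b _ /=.
rewrite [tensmx _ _ *m _]mulmxA (lG b) -scalemxAl -scalemxAr -scalemxAl.
rewrite linearZ scalemx_sub //=.
by apply: (eq_row_sub b); rewrite rowK.
Qed.

End SpanMu.
End Ancilla.

Theorem theorem3 (R : realType) (n m p : nat)
    (Phi : 'I_(2 ^ n * 2 ^ m) -> 'cV[R[i]]_(2 ^ n * 2 ^ m)) :
  stabilizer_basis (n + m) (2 ^ n * 2 ^ m)%N (is_pauli_nm n m) Phi ->
  (forall b, ent_entropy_is n m (Phi b) p%:R) ->
  (forall psi : 'cV[R[i]]_(2 ^ m), unit_vec psi ->
     (s_mu n m psi Phi <= 2 ^ (n + p))%N) /\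
  ((exists psi : 'cV[R[i]]_(2 ^ m), unit_vec psi /\ s_mu n m psi Phi = 4 ^ n)%N
     <-> (n <= m /\ p = n)%N).
Proof.
move=> [ortho [g [gP _ indep eig]]] ent.
have [LA [PA [eA [FA PAs _]]]] := @pauli_str_frame R n.
have [LB [PB [eB [FB PBs [psi0 [psi01 psi0P]]]]]] := @pauli_str_frame R m.
have FAB := frame_tens FA FB.
have Phi1 b : unit_vec (Phi b) by rewrite /unit_vec ortho eqxx.
have n0 : (0 < 2 ^ n)%N by rewrite expn_gt0.
have m0 : (0 < 2 ^ m)%N by rewrite expn_gt0.
have nm0 : (0 < 2 ^ n * 2 ^ m)%N by rewrite muln_gt0 n0.
pose b : 'I_(2 ^ n * 2 ^ m) := Ordinal nm0.
set G := stab (fun l : LA * LB => tensmx (PA l.1) (PB l.2)) Phi.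
have Gbig : (2 ^ n * 2 ^ m <= #|G|)%N.
  rewrite -expnD; apply: (stab_card_generators FAB ortho _ indep eig) => i.
  have [c [s [t [cP ->]]]] := gP i.
  have [[l <-] [k <-]] := (PAs s, PBs t).
  exists c, (l, k); split=> //.
  by case: cP => ->; rewrite ?oppr_eq0 ?oner_eq0 ?neq0Ci.
have [Gcard _] := stab_max nm0 FAB Phi1 b Gbig.
have cardA : (#|@stabA R _ _ _ _ PA PB eB _ Phi| * 2 ^ p = 2 ^ n)%N.
  have := ent b; rewrite /ent_entropy_is ptrace_anc_unvec.
  apply: flat_entropy => //; first by rewrite -mxtrace_unvec unit_vec_trace.
  exact: (reduced_state_sq n0 m0 FA FB Phi1 Gbig).
have cardB : (#|@stabB R _ _ _ _ PA PB eA _ Phi| * 2 ^ p = 2 ^ m)%N.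
  have := card_stabA_stabB n0 m0 FA FB Phi1 Gbig b.
  move=> /(congr1 (muln^~ (2 ^ p)%N)); rewrite -!mulnA cardA => /eqP.
  by rewrite mulnC eqn_pmul2l // => /eqP.
have cardP : (#|@stab_proj R _ _ _ _ PA PB _ Phi| = 2 ^ (n + p))%N.
  have B0 : (0 < #|@stabB R _ _ _ _ PA PB eA _ Phi|)%N.
    by rewrite lt0n; apply: contra_eq_neq cardB => ->; rewrite mul0n eq_sym -lt0n.
  apply/eqP; rewrite -(eqn_pmul2r B0) -(card_stab_proj m0 FA FB Phi1) -/G Gcard.
  by rewrite expnD -mulnA [(2 ^ p * _)%N]mulnC cardB.
(* Applied to [cardA] and [cardB], this bounds [p] by both [n] and [m]. *)
have le_p a k : (k * 2 ^ p = 2 ^ a)%N -> (p <= a)%N.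
  move=> E; rewrite -(leq_exp2l (m := 2)) // -E leq_pmull // lt0n.
  by apply: contra_eq_neq E => ->; rewrite mul0n eq_sym -lt0n expn_gt0.
have pn := le_p _ _ cardA; have pm := le_p _ _ cardB.
have upper psi : (s_mu n m psi Phi <= 2 ^ (n + p))%N.
  by rewrite -cardP; exact: (s_mu_le FA FB ortho Gbig).
split=> [psi _ //|]; split=> [[psi [_ full]]|[_ pE]].
  have np : (n <= p)%N.
    have := upper psi; rewrite full -[4%N]/(2 ^ 2)%N -expnM.
    by rewrite leq_exp2l // mul2n -addnn leq_add2l.
  by split; [exact: leq_trans np pm | apply/eqP; rewrite eqn_leq pn].
exists psi0; split=> //; apply: (s_mu_full FA ortho) => // s.
(* When [p = n], the projection has [2 ^ (n + n)] elements, as many as there are data labels, so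
   every data Pauli occurs. *)
have /eqP/setP/(_ s) : @stab_proj R _ _ _ _ PA PB _ Phi == setT; last by rewrite inE.
by rewrite eqEcard subsetT cardsT cardP (frame_card FA) pE expnD leqnn.
Qed.
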